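(* Let $M$ be a commutative monoid and $\mathcal{A}\in\mathcal{H}(M)$ a system of abelian groups over $M$. There is an equivalence of groupoids $$\mathsf{Coext}(M,\mathcal{A})\;\simeq\;[\mathsf{C}^0(M,\mathcal{A})\xrightarrow{\partial^0}\ker\partial^1],$$ where the right-hand side is the groupoid obtained from the action of $\mathsf{C}^0(M,\mathcal{A})$ on $\ker\partial^1$ via $\partial^0$.
   Context: **Systems.** All monoids are commutative, written multiplicatively with unit $1$. A system of abelian groups $\mathcal{A}$ over $M$ consists of an abelian group $\mathcal{A}(a)$ for each $a\in M$ and homomorphisms $r_*:\mathcal{A}(a)\to\mathcal{A}(ra)$ for all $r,a\in M$ with $1_*=\mathrm{id}$ and $(rs)_*=r_*\circ s_*$. Morphisms are families of homomorphisms $\mathcal{A}(a)\to\mathcal{B}(a)$ commuting with all $r_*$; the category is $\mathcal{H}(M)$. **Coextensions.** A coextension $0\to\mathcal{A}\to N\xrightarrow{\pi}M\to0$ of $M$ by $\mathcal{A}$ is a surjective monoid homomorphism $\pi:N\to M$ with an action $\bullet$ of the group $\mathcal{A}(m)$ on $\pi^{-1}(m)$ for each $m\in M$ such that (i) for $n,n'\in\pi^{-1}(m)$ there is a unique $x\in\mathcal{A}(m)$ with $n'=x\bullet n$; (ii) $(x\bullet n)(y\bullet n')=(m'_*(x)+m_*(y))\bullet(nn')$ for $x\in\mathcal{A}(m)$, $n\in\pi^{-1}(m)$, $y\in\mathcal{A}(m')$, $n'\in\pi^{-1}(m')$. $\mathsf{Coext}(M,\mathcal{A})$ is the category of coextensions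 of $M$ by $\mathcal{A}$, a morphism from $\pi:N\to M$ to $\pi':N'\to M$ being a monoid homomorphism $h:N\to N'$ with $\pi'h=\pi$ and $h(x\bullet n)=x\bullet h(n)$. **Grillet complex.** $\mathsf{C}^0(M,\mathcal{A})$ is the group of functions $g$ with $g(a)\in\mathcal{A}(a)$ for $a\in M$. $\mathsf{C}^1(M,\mathcal{A})$ is the group of functions $f$ with $f(a,b)\in\mathcal{A}(ab)$ and $f(a,b)=f(b,a)$. $\mathsf{C}^2(M,\mathcal{A})$ is the group of functions $h$ with $h(a,b,c)\in\mathcal{A}(abc)$ and $h(a,b,c)-h(b,a,c)+h(b,c,a)=0$. The maps $\partial^0:\mathsf{C}^0\to\mathsf{C}^1$, $\partial^1:\mathsf{C}^1\to\mathsf{C}^2$ are $$(\partial^0g)(a,b)=a_*g(b)-g(ab)+b_*g(a),\qquad(\partial^1f)(a,b,c)=a_*f(b,c)-f(ab,c)+f(a,bc)-c_*f(a,b),$$ and $\partial^1\partial^0=0$. **Groupoid of a homomorphism.** For a homomorphism $\alpha:A\to B$ of abelian groups, $[A\xrightarrow{\alpha}B]$ is the groupoid whose objects are the elements of $B$ and whose morphisms $b'\to b$ are the elements $a\in A$ with $\alpha(a)+b=b'$, with composition given by addition. *)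

(* Defs.v *)
From HB Require Import structures.
From mathcomp Require Import all_boot all_order all_algebra.
From mathcomp Require Import boolp.

Set Implicit Arguments.
Unset Strict Implicit.
Unset Printing Implicit Defensive.

Import GRing.Theory.
Local Open Scope ring_scope.

Record category := Category {
  Obj :> Type;
  Hom : Obj -> Obj -> Type;
  idm : forall x, Hom x x;
  comp : forall x y z, Hom y z -> Hom x y -> Hom x z;
  comp_idl : forall x y (f : Hom x y), comp (idm y) f = f;
  comp_idr : forall x y (f : Hom x y), comp f (idm x) = f;
  compA : forall x y z t (h : Hom z t) (g : Hom y z) (f : Hom x y),
    comp h (comp g f) = comp (comp h g) f }.

Arguments Hom {c} x y.
Arguments idm {c} x.
Arguments comp {c x y z} g f.

Definition is_iso (C : category) (x y : C) (f : Hom x y) : Prop :=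
  exists g : Hom y x, comp g f = idm x /\ comp f g = idm y.

Definition is_groupoid (C : category) : Prop :=
  forall (x y : C) (f : Hom x y), is_iso f.

Record functor (C D : category) := Functor {
  fobj :> C -> D;
  fmap : forall x y : C, Hom x y -> Hom (fobj x) (fobj y);
  fmap_id : forall x : C, fmap (idm x) = idm (fobj x);
  fmap_comp : forall (x y z : C) (g : Hom y z) (f : Hom x y),
    fmap (comp g f) = comp (fmap g) (fmap f) }.

Definition id_functor (C : category) : functor C C :=
  @Functor C C (fun x => x) (fun _ _ f => f)
    (fun=> erefl) (fun _ _ _ _ _ => erefl).

Lemma comp_functor_id (C D E : category) (G : functor D E) (F : functor C D)
  (x : C) : fmap G (fmap F (idm x)) = idm (G (F x)).
Proof. by rewrite !fmap_id. Qed.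

Lemma comp_functor_comp (C D E : category) (G : functor D E) (F : functor C D)
  (x y z : C) (g : Hom y z) (f : Hom x y) :
  fmap G (fmap F (comp g f)) = comp (fmap G (fmap F g)) (fmap G (fmap F f)).
Proof. by rewrite !fmap_comp. Qed.

Definition comp_functor (C D E : category) (G : functor D E) (F : functor C D) :
    functor C E :=
  @Functor C E (fun x => G (F x)) (fun x y f => fmap G (fmap F f))
    (comp_functor_id G F) (comp_functor_comp G F).

Definition naturally_isomorphic (C D : category) (F G : functor C D) : Prop :=
  exists eta : forall x : C, Hom (F x) (G x),
    (forall x, is_iso (eta x)) /\
    (forall (x y : C) (f : Hom x y),
       comp (eta y) (fmap F f) = comp (fmap G f) (eta x)).

Definition equivalent (C D : category) : Prop :=
  exists (F : functor C D) (G : functor D C),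
    naturally_isomorphic (comp_functor G F) (id_functor C) /\
    naturally_isomorphic (comp_functor F G) (id_functor D).

Section ActionGroupoid.
Variables (A B : zmodType) (alpha : {additive A -> B}).

Definition action_hom (b' b : B) := {a : A | alpha a + b == b'}.

Lemma action_id_subproof (b : B) : alpha 0 + b == b.
Proof. by rewrite raddf0 add0r. Qed.

Definition action_id (b : B) : action_hom b b :=
  exist _ 0 (action_id_subproof b).

Lemma action_comp_subproof (b'' b' b : B)
  (a : action_hom b' b) (a' : action_hom b'' b') :
  alpha (val a + val a') + b == b''.
Proof.
case: a a' => [a /= /eqP ea] [a' /= /eqP ea'].
by rewrite raddfD addrAC ea addrC ea'.
Qed.

Definition action_comp (b'' b' b : B)
    (a : action_hom b' b) (a' : action_hom b'' b') : action_hom b'' b :=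
  exist _ (val a + val a') (action_comp_subproof a a').

Lemma action_comp_idl (x y : B) (f : action_hom x y) :
  action_comp (action_id y) f = f.
Proof. by apply: val_inj; rewrite /= add0r. Qed.

Lemma action_comp_idr (x y : B) (f : action_hom x y) :
  action_comp f (action_id x) = f.
Proof. by apply: val_inj; rewrite /= addr0. Qed.

Lemma action_compA (x y z t : B)
  (h : action_hom z t) (g : action_hom y z) (f : action_hom x y) :
  action_comp h (action_comp g f) = action_comp (action_comp h g) f.
Proof. by apply: val_inj; rewrite /= addrA. Qed.

Definition action_groupoid : category :=
  @Category B action_hom action_id action_comp
    action_comp_idl action_comp_idr action_compA.

End ActionGroupoid.

Section Kernel.
Variables (U V : zmodType) (f : {additive U -> V}).

Definition ker_pred : {pred U} := fun x => f x == 0.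

Lemma ker_zmod_closed : zmod_closed ker_pred.
Proof.
split=> [|x y /eqP fx /eqP fy]; apply/eqP; first exact: raddf0.
by rewrite raddfB fx fy subrr.
Qed.

HB.instance Definition _ := GRing.isZmodClosed.Build U ker_pred ker_zmod_closed.

Record ker := Ker { ker_val :> U; _ : ker_val \in ker_pred }.

HB.instance Definition _ := [isSub for ker_val].
HB.instance Definition _ := [Choice of ker by <:].
HB.instance Definition _ := [SubChoice_isSubZmodule of ker by <:].

End Kernel.

Definition dfun (I : Type) (V : I -> zmodType) : Type := forall i, V i.

Section DependentFunctions.
Variables (I : Type) (V : I -> zmodType).
Implicit Types f g h : dfun V.

HB.instance Definition _ := gen_eqMixin (dfun V).
HB.instance Definition _ := gen_choiceMixin (dfun V).

Definition dfun0 : dfun V := fun=> 0.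
Definition dfunN f : dfun V := fun i => - f i.
Definition dfunD f g : dfun V := fun i => f i + g i.

Lemma dfun_addA : associative dfunD.
Proof. by move=> f g h; apply: functional_extensionality_dep => i; exact: addrA. Qed.
Lemma dfun_addC : commutative dfunD.
Proof. by move=> f g; apply: functional_extensionality_dep => i; exact: addrC. Qed.
Lemma dfun_add0 : left_id dfun0 dfunD.
Proof. by move=> f; apply: functional_extensionality_dep => i; exact: add0r. Qed.
Lemma dfun_addN : left_inverse dfun0 dfunN dfunD.
Proof. by move=> f; apply: functional_extensionality_dep => i; exact: addNr. Qed.

HB.instance Definition _ :=
  GRing.isZmodule.Build (dfun V) dfun_addA dfun_addC dfun_add0 dfun_addN.

End DependentFunctions.

(* [monoidType] carries a choice structure; classically every type has one
   ([gen_choiceMixin]), so this does not restrict the monoids considered. *)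
HB.mixin Record Magma_isCommutative G of Magma G := {
  mulgC : commutative (@monoid.mul G)
}.

#[short(type="comMonoidType")]
HB.structure Definition ComMonoid := {G of Magma_isCommutative G & Monoid G}.

(* [ecast] transports along an equality in [M]: [A(1a)] and [A a], or [A(r(sa))]
   and [A((rs)a)], are not convertible types. *)
Record system (M : comMonoidType) := System {
  sys :> M -> zmodType;
  push : forall r a : M, {additive sys a -> sys (r * a)%g};
  push1 : forall (a : M) (x : sys a),
    ecast c (sys c) (mul1g a) (push 1%g a x) = x;
  pushM : forall (r s a : M) (x : sys a),
    push (r * s)%g a x =
    ecast c (sys c) (mulgA r s a) (push r (s * a)%g (push s a x)) }.

Arguments push {M A} r {a} : rename.

Section Transport.
Variables (M : comMonoidType) (A : system M).

Definition tr (a b : M) (e : a = b) (x : A a) : A b := ecast c (A c) e x.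

Lemma tr_is_zmod (a b : M) (e : a = b) : zmod_morphism (tr e).
Proof. by move=> x y; case: b / e. Qed.

HB.instance Definition _ a b e :=
  GRing.isZmodMorphism.Build (A a) (A b) (tr e) (tr_is_zmod e).

Lemma tr0 (a b : M) (e : a = b) : tr e 0 = 0.
Proof. exact: raddf0. Qed.

Lemma trB (a b : M) (e : a = b) : {morph tr e : x y / x - y}.
Proof. exact: raddfB. Qed.

Lemma trD (a b : M) (e : a = b) : {morph tr e : x y / x + y}.
Proof. exact: raddfD. Qed.

Lemma tr_irr (a b : M) (e e' : a = b) (x : A a) : tr e x = tr e' x.
Proof. by rewrite (eq_irrelevance e e'). Qed.

Lemma tr_id (a : M) (e : a = a) (x : A a) : tr e x = x.
Proof. by rewrite (tr_irr e erefl). Qed.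

Lemma tr_tr (a b c : M) (e : a = b) (e' : b = c) (x : A a) :
  tr e' (tr e x) = tr (etrans e e') x.
Proof. by case: c / e'; case: b / e. Qed.

Lemma tr_dep (I : eqType) (k : I -> M) (F : forall i, A (k i)) (i j : I)
  (e : i = j) (e' : k i = k j) : tr e' (F i) = F j.
Proof. by case: j / e in e' *; rewrite tr_id. Qed.

Lemma push_tr (r a b : M) (e : a = b) (x : A a) :
  push r (tr e x) = tr (congr1 (monoid.mul r) e) (push r x).
Proof. by case: b / e. Qed.

Lemma push_l (r r' a c : M) (x : A a) (e : r = r')
  (e1 : (r * a = c)%g) (e2 : (r' * a = c)%g) :
  tr e1 (push r x) = tr e2 (push r' x).
Proof. by case: r' / e in e2 *; exact: tr_irr. Qed.

Lemma push_push (r s a : M) (x : A a) :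
  push r (push s x) = tr (esym (mulgA r s a)) (push (r * s)%g x).
Proof. by rewrite pushM -/(tr _ _) tr_tr tr_id. Qed.

End Transport.

Lemma mulgCAr (M : comMonoidType) (a b c : M) : (b * a * c = a * b * c)%g.
Proof. by rewrite (mulgC b a). Qed.

Lemma mulg_rot (M : comMonoidType) (a b c : M) : (b * c * a = a * b * c)%g.
Proof. by rewrite mulgC mulgA. Qed.

Section Grillet.
Variables (M : comMonoidType) (A : system M).

Definition C0 := dfun A.

Definition fun2 := dfun (fun a : M => dfun (fun b : M => A (a * b)%g)).

Definition C1_pred : {pred fun2} := fun f =>
  `[< forall a b : M, f a b = tr (mulgC b a) (f b a) >].

Lemma C1_zmod_closed : zmod_closed C1_pred.
Proof.
split=> [|f g /asboolP fS /asboolP gS]; apply/asboolP => a b.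
  by rewrite tr0.
have E x y : (f - g) x y = f x y - g x y by [].
by rewrite !E trB -fS -gS.
Qed.

HB.instance Definition _ := GRing.isZmodClosed.Build fun2 C1_pred C1_zmod_closed.

Record C1 := MkC1 { C1_val :> fun2; _ : C1_val \in C1_pred }.

HB.instance Definition _ := [isSub for C1_val].
HB.instance Definition _ := [Choice of C1 by <:].
HB.instance Definition _ := [SubChoice_isSubZmodule of C1 by <:].

Definition fun3 :=
  dfun (fun a : M => dfun (fun b : M => dfun (fun c : M => A (a * b * c)%g))).

Definition C2_pred : {pred fun3} := fun h =>
  `[< forall a b c : M,
        h a b c - tr (mulgCAr a b c) (h b a c) + tr (mulg_rot a b c) (h b c a)
        = 0 >].

Lemma C2_zmod_closed : zmod_closed C2_pred.
Proof.
split=> [|f g /asboolP fS /asboolP gS]; apply/asboolP => a b c.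
  by rewrite !tr0 subr0 addr0.
have E x y z : (f - g) x y z = f x y z - g x y z by [].
rewrite !E !trB -[RHS]subr0 -{1}(fS a b c) -(gS a b c).
by rewrite !opprD !opprK !addrA [LHS](ACl (1*3*5*2*4*6)).
Qed.

HB.instance Definition _ := GRing.isZmodClosed.Build fun3 C2_pred C2_zmod_closed.

Record C2 := MkC2 { C2_val :> fun3; _ : C2_val \in C2_pred }.

HB.instance Definition _ := [isSub for C2_val].
HB.instance Definition _ := [Choice of C2 by <:].
HB.instance Definition _ := [SubChoice_isSubZmodule of C2 by <:].

Definition d0_fun (g : C0) : fun2 := fun a b =>
  push a (g b) - g (a * b)%g + tr (mulgC b a) (push b (g a)).

Lemma d0_subproof (g : C0) : d0_fun g \in C1_pred.
Proof.
apply/asboolP => a b; rewrite /d0_fun trD trB tr_tr tr_id.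
rewrite (tr_dep (k := id) g (mulgC b a)).
by rewrite [LHS]addrAC [RHS]addrAC [X in _ = X + _]addrC.
Qed.

Definition d0 (g : C0) : C1 := MkC1 (d0_subproof g).

Lemma d0_is_zmod : zmod_morphism d0.
Proof.
move=> g g'; apply: val_inj; apply: functional_extensionality_dep => a.
apply: functional_extensionality_dep => b; rewrite /= /d0_fun.
have E x : (g - g') x = g x - g' x by [].
rewrite !E !raddfB /=.
have -> : (d0_fun g - d0_fun g') a b = d0_fun g a b - d0_fun g' a b by [].
rewrite /d0_fun !opprD !opprK !addrA [LHS](ACl (1*3*5*2*4*6)).
by [].
Qed.

HB.instance Definition _ := GRing.isZmodMorphism.Build C0 C1 d0 d0_is_zmod.

Definition d1_fun (f : fun2) : fun3 := fun a b c =>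
  tr (mulgA a b c) (push a (f b c)) - f (a * b)%g c
  + tr (mulgA a b c) (f a (b * c)%g)
  - tr (mulgC c (a * b)%g) (push c (f a b)).

Lemma C1_sym (f : C1) (a b : M) (e : (b * a = a * b)%g) :
  tr e (val f b a) = val f a b.
Proof. by case: f => f /= /asboolP fS; rewrite [RHS]fS; exact: tr_irr. Qed.

Lemma d1_abel (V : zmodType) (P Q R S T U : V) :
  P - Q + R - S - (T - Q + U - S) + (T - R + U - P) = 0.
Proof.
rewrite !opprD !opprK !addrA.
rewrite [LHS](ACl ((1*12)*(2*6)*(3*10)*(4*8)*(5*9)*(7*11))) /=.
by rewrite !(subrr, addNr, addr0).
Qed.

Lemma push_sym (f : C1) (x a b c : M)
  (e : (x * (b * a) = c)%g) (e' : (x * (a * b) = c)%g) :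
  tr e (push x (val f b a)) = tr e' (push x (val f a b)).
Proof. by rewrite -(C1_sym f (mulgC a b)) push_tr tr_tr; exact: tr_irr. Qed.

Lemma tr_sym (f : C1) (a b c : M) (e : (b * a = c)%g) (e' : (a * b = c)%g) :
  tr e (val f b a) = tr e' (val f a b).
Proof. by rewrite -(C1_sym f (mulgC a b)) tr_tr; exact: tr_irr. Qed.

Lemma d1_subproof (f : C1) : d1_fun f \in C2_pred.
Proof.
apply/asboolP => a b c; rewrite /d1_fun !(trB, trD) !tr_tr.
set P := tr _ (push a (val f b c)); set Q := val f (a * b)%g c.
set R := tr _ (val f a _); set S := tr _ (push c (val f a b)).
set T := tr _ (push b (val f a c)); set U := tr _ (val f b _).
have -> : tr (mulgCAr a b c) (val f (b * a)%g c) = Q.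
  exact: (@tr_dep M A M (fun x => x * c)%g (fun x => val f x c) _ _ (mulgC b a)).
rewrite (@push_sym f c a b _ _ (mulgC c (a * b)%g)) -/S.
rewrite (@push_sym f b a c _ _ (etrans (mulgA b a c) (mulgCAr a b c))) -/T.
rewrite (@tr_sym f a (b * c)%g _ _ (mulgA a b c)) -/R.
have -> : tr (etrans (mulgA b c a) (mulg_rot a b c)) (val f b (c * a)%g) = U.
  have ec := mulgC a c.
  have <- := @tr_dep M A M (fun x => b * x)%g (fun x => val f b x) _ _ ec
               (congr1 (monoid.mul b) ec).
  rewrite tr_tr.
  exact: tr_irr.
rewrite (tr_irr (etrans (mulgC a _) _) (mulgA a b c)) -/P.
exact: d1_abel.
Qed.

Definition d1 (f : C1) : C2 := MkC2 (d1_subproof f).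

Lemma d1_is_zmod : zmod_morphism d1.
Proof.
move=> f f'; apply: val_inj; apply: functional_extensionality_dep => a.
apply: functional_extensionality_dep => b.
apply: functional_extensionality_dep => c.
have E x y : val (f - f') x y = val f x y - val f' x y by [].
change (d1_fun (val (f - f')) a b c
        = d1_fun (val f) a b c - d1_fun (val f') a b c).
rewrite /d1_fun !E !raddfB /= !opprD !opprK !addrA.
by rewrite [LHS](ACl (1*3*5*7*2*4*6*8)).
Qed.

HB.instance Definition _ := GRing.isZmodMorphism.Build C1 C2 d1 d1_is_zmod.

Lemma d1d0_abel (V : zmodType) (P Q R S T U : V) :
  P - Q + R + (- P - - S - T) + (Q - S + U) + (- R - - T - U) = 0.
Proof.
rewrite !opprK !addrA.
rewrite [LHS](ACl ((1*4)*(2*7)*(3*10)*(5*8)*(6*11)*(9*12))) /=.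
by rewrite !(subrr, addNr, addr0).
Qed.

Lemma d1_d0 (g : C0) : d1 (d0 g) = 0.
Proof.
apply: val_inj; apply: functional_extensionality_dep => a.
apply: functional_extensionality_dep => b.
apply: functional_extensionality_dep => c.
rewrite /= /d1_fun /= /d0_fun !(trB, trD, raddfB, raddfD) /=.
rewrite !(push_tr, push_push, tr_tr).
rewrite tr_id (tr_dep (k := id) g (mulgA a b c)).
rewrite (push_l (g b) (mulgC c a) _
  (etrans (esym (mulgA a c b))
     (etrans (congr1 (monoid.mul a) (mulgC c b)) (mulgA a b c)))).
rewrite (push_l (g a) (mulgC c b) _
  (etrans (mulgC (b * c)%g a) (mulgA a b c))).
exact: d1d0_abel.
Qed.

Lemma d0_ker_subproof (g : C0) : d0 g \in ker_pred d1.
Proof. by apply/eqP; exact: d1_d0. Qed.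

Definition d0_ker (g : C0) : ker d1 := Ker (d0_ker_subproof g).

Lemma d0_ker_is_zmod : zmod_morphism d0_ker.
Proof. by move=> g g'; apply: val_inj; exact: d0_is_zmod. Qed.

HB.instance Definition _ :=
  GRing.isZmodMorphism.Build C0 (ker d1) d0_ker d0_ker_is_zmod.

End Grillet.

Definition fiber (N M : comMonoidType) (p : N -> M) (m : M) : Type :=
  {n : N | p n == m}.

Section Fibers.
Variables (N M : comMonoidType) (p : N -> M).

Lemma fiber_mul_subproof (pM : monoid.monoid_morphism p) (m m' : M)
  (n : fiber p m) (n' : fiber p m') : p (val n * val n')%g == (m * m')%g.
Proof.
by case: n n' => [n /= /eqP en] [n' /= /eqP en']; rewrite (snd pM) en en'.
Qed.

Definition fiber_mul (pM : monoid.monoid_morphism p) (m m' : M)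
    (n : fiber p m) (n' : fiber p m') : fiber p (m * m')%g :=
  exist _ (val n * val n')%g (fiber_mul_subproof pM n n').

Variables (N' : comMonoidType) (p' : N' -> M) (h : N -> N').

Lemma fiber_map_subproof (hp : forall n, p' (h n) = p n) (m : M)
  (n : fiber p m) : p' (h (val n)) == m.
Proof. by rewrite hp (valP n). Qed.

Definition fiber_map (hp : forall n, p' (h n) = p n) (m : M) (n : fiber p m) :
    fiber p' m :=
  exist _ (h (val n)) (fiber_map_subproof hp n).

End Fibers.

Section Coextensions.
Variables (M : comMonoidType) (A : system M).

Record coextension := Coextension {
  cx_monoid :> comMonoidType;
  cx_proj : cx_monoid -> M;
  cx_proj_morph : monoid.monoid_morphism cx_proj;
  cx_proj_surj : forall m : M, exists n : cx_monoid, cx_proj n = m;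
  cx_act : forall m : M, A m -> fiber cx_proj m -> fiber cx_proj m;
  cx_act0 : forall (m : M) (n : fiber cx_proj m), cx_act 0 n = n;
  cx_actD : forall (m : M) (x y : A m) (n : fiber cx_proj m),
    cx_act (x + y) n = cx_act x (cx_act y n);
  cx_act_unique : forall (m : M) (n n' : fiber cx_proj m),
    exists! x : A m, n' = cx_act x n;
  cx_act_mul : forall (m m' : M) (x : A m) (n : fiber cx_proj m)
      (y : A m') (n' : fiber cx_proj m'),
    fiber_mul cx_proj_morph (cx_act x n) (cx_act y n') =
    cx_act (tr (mulgC m' m) (push m' x) + push m y)
      (fiber_mul cx_proj_morph n n') }.

Record coext_hom (E E' : coextension) := CoextHom {
  ch_fun :> E -> E';
  ch_morph : monoid.monoid_morphism ch_fun;
  ch_proj : forall n : E, cx_proj (ch_fun n) = cx_proj n;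
  ch_act : forall (m : M) (x : A m) (n : fiber (@cx_proj E) m),
    fiber_map ch_proj (cx_act x n) = cx_act x (fiber_map ch_proj n) }.

Lemma coext_hom_eq (E E' : coextension) (h h' : coext_hom E E') :
  (forall n, h n = h' n) -> h = h'.
Proof.
case: h h' => [f fM fp fa] [f' fM' fp' fa'] /= ff.
have {ff} e : f = f' by apply: functional_extensionality_dep => n; exact: ff.
case: f' / e in fM' fp' fa' *.
have ? : fM = fM' by exact: Prop_irrelevance.
have ? : fp = fp' by exact: Prop_irrelevance.
by subst; congr CoextHom; exact: Prop_irrelevance.
Qed.

Section Identity.
Variable E : coextension.

Lemma coext_id_morph : monoid.monoid_morphism (fun n : E => n).
Proof. by []. Qed.

Lemma coext_id_act (m : M) (x : A m) (n : fiber (@cx_proj E) m) :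
  let idp (n : E) := erefl (cx_proj n) in
  fiber_map idp (cx_act x n) = cx_act x (fiber_map idp n).
Proof.
have e : forall k : fiber (@cx_proj E) m,
  fiber_map (h := id) (fun n => erefl (cx_proj n)) k = k.
  by move=> k; exact: val_inj.
by rewrite /= !e.
Qed.

Definition coext_id : coext_hom E E := CoextHom coext_id_morph coext_id_act.

End Identity.

Section Composition.
Variables (E E' E'' : coextension) (h' : coext_hom E' E'') (h : coext_hom E E').

Lemma coext_comp_morph : monoid.monoid_morphism (fun n => h' (h n)).
Proof.
split=> [|n n']; first by rewrite (fst (ch_morph h)) (fst (ch_morph h')).
by rewrite (snd (ch_morph h)) (snd (ch_morph h')).
Qed.

Lemma coext_comp_proj (n : E) : cx_proj (h' (h n)) = cx_proj n.
Proof. by rewrite !ch_proj. Qed.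

Lemma coext_comp_act (m : M) (x : A m) (n : fiber (@cx_proj E) m) :
  fiber_map coext_comp_proj (cx_act x n) =
  cx_act x (fiber_map coext_comp_proj n).
Proof.
have e : forall k : fiber (@cx_proj E) m, fiber_map coext_comp_proj k =
    fiber_map (ch_proj h') (fiber_map (ch_proj h) k).
  by move=> k; exact: val_inj.
by rewrite !e !ch_act.
Qed.

Definition coext_comp : coext_hom E E'' :=
  CoextHom coext_comp_morph coext_comp_act.

End Composition.

Lemma coext_comp_idl (E E' : coextension) (h : coext_hom E E') :
  coext_comp (coext_id E') h = h.
Proof. exact: coext_hom_eq. Qed.

Lemma coext_comp_idr (E E' : coextension) (h : coext_hom E E') :
  coext_comp h (coext_id E) = h.
Proof. exact: coext_hom_eq. Qed.

Lemma coext_compA (E1 E2 E3 E4 : coextension) (h3 : coext_hom E3 E4)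
  (h2 : coext_hom E2 E3) (h1 : coext_hom E1 E2) :
  coext_comp h3 (coext_comp h2 h1) = coext_comp (coext_comp h3 h2) h1.
Proof. exact: coext_hom_eq. Qed.

Definition Coext : category :=
  @Category coextension coext_hom coext_id coext_comp
    coext_comp_idl coext_comp_idr coext_compA.

End Coextensions.

(* Main.v *)
From HB Require Import structures.
From mathcomp Require Import all_boot all_algebra.
From mathcomp Require Import boolp.
Require Import Defs.

Set Implicit Arguments.
Unset Strict Implicit.
Unset Printing Implicit Defensive.

Import GRing.Theory.
Local Open Scope ring_scope.

(** A coextension becomes trivial as a torsor once one element is chosen in
    each fibre, and what is left of the multiplication is then a 2-cocycle.

    Concretely, a symmetric cocycle [f] in the kernel of the second coboundary
    gives a commutative monoid on the pairs [(a, x)] with [x] in [A a], with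
    product [(a, x) (b, y) = (ab, b_* x + a_* y + f a b)]: the cocycle identity is
    its associativity ([twisted_mulA]), symmetry is its commutativity, and
    [(1, - f 1 1)] is the unit because the cocycle identity at [(1, 1, c)] reads
    [f 1 c = c_* (f 1 1)] ([cocycle1]).  This is a coextension
    ([twisted_coext]), where [A a] acts by addition on the second component.

    A map [(a, x) |-> (a, x + g a)] from the coextension of [f] to that of [f'] is
    multiplicative exactly when [f] is [f'] plus the coboundary of [g], that is,
    when [g] is an arrow [f -> f'] of the action groupoid.  This defines a functor
    ([twisted_functor]).  It is fully faithful, since a morphism of coextensions
    is equivariant and hence determined by the images of the points [(a, 0)].
    It is essentially surjective: given a coextension [E], pick [s m] over each
    [m]; the elements [c a b] with [s a * s b = c a b . s (ab)] form a cocycle,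
    and [(a, x) |-> x . s a] is a morphism to [E] ([transversal_hom]).

    Every morphism of coextensions is a bijection, as on each fibre it is an
    equivariant map between torsors, and its inverse is again a morphism
    ([Coext_groupoid]).  So the last map is automatically an isomorphism, and a
    fully faithful, essentially surjective functor is an equivalence
    ([equivalent_of_functor]). *)

(** * Equivalences of categories *)

Section FullyFaithful.
Variables (C D : category) (G : functor D C).

Definition fully_faithful : Prop :=
  forall (x y : D) (h : Hom (G x) (G y)), exists! k : Hom x y, fmap G k = h.

Definition essentially_surjective : Prop :=
  forall c : C, exists (d : D) (h : Hom (G d) c), is_iso h.

(** The quasi-inverse picks a preimage of each object up to isomorphism, so it
    rests on the axiom of choice. *)
Lemma equivalent_of_functor :
  fully_faithful -> essentially_surjective -> equivalent C D.
Proof.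
move=> ff es.
pose obj c : D := projT1 (cid (es c)).
pose eps c : Hom (G (obj c)) c := projT1 (cid (projT2 (cid (es c)))).
have eps_iso c : is_iso (eps c) := projT2 (cid (projT2 (cid (es c)))).
pose inv c : Hom c (G (obj c)) := projT1 (cid (eps_iso c)).
have invl c : comp (inv c) (eps c) = idm _.
  by case: (projT2 (cid (eps_iso c))).
have invr c : comp (eps c) (inv c) = idm _.
  by case: (projT2 (cid (eps_iso c))).
pose lift x y (h : Hom (G x) (G y)) : Hom x y := projT1 (cid (ff x y h)).
have liftK x y (h : Hom (G x) (G y)) : fmap G (lift x y h) = h.
  by case: (projT2 (cid (ff x y h))).
have faithful x y (k k' : Hom x y) : fmap G k = fmap G k' -> k = k'.
  move=> e; case: (ff x y (fmap G k)) => k0 [_ k0_uniq].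
  by rewrite -(k0_uniq k erefl) -(k0_uniq k' (esym e)).
pose mor c c' (f : Hom c c') : Hom (obj c) (obj c') :=
  lift _ _ (comp (inv c') (comp f (eps c))).
have mor_id c : mor c c (idm c) = idm (obj c).
  by apply: faithful; rewrite liftK comp_idl invl fmap_id.
have mor_comp c c' c'' (g : Hom c' c'') (f : Hom c c') :
    mor c c'' (comp g f) = comp (mor c' c'' g) (mor c c' f).
  apply: faithful; rewrite fmap_comp !liftK -!compA.
  by congr (comp _ (comp _ _)); rewrite !compA invr comp_idl.
pose F : functor C D := Functor mor_id mor_comp.
exists F, G; split.
  exists eps; split=> // c c' f.
  by rewrite /= liftK !compA invr comp_idl.
exists (fun d => lift (F (G d)) d (eps (G d))); split=> [d|d d' k].
  exists (lift d (F (G d)) (inv (G d))).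
  by split; apply: faithful; rewrite fmap_comp !liftK fmap_id (invl, invr).
apply: faithful; rewrite /= !fmap_comp !liftK.
by rewrite compA invr comp_idl.
Qed.

End FullyFaithful.

Lemma action_groupoid_is_groupoid (A B : zmodType) (alpha : {additive A -> B}) :
  is_groupoid (action_groupoid alpha).
Proof.
move=> b' b [a /= ea].
have ea' : alpha (- a) + b' == b by rewrite -(eqP ea) raddfN addKr.
exists (exist _ (- a) ea' : action_hom alpha b b').
by split; apply: val_inj; rewrite /= (addNr, addrN).
Qed.

(** * Coextensions and their morphisms *)

Section CoextensionTheory.
Variables (M : comMonoidType) (A : system M).
Implicit Types E : coextension A.

Lemma tr_push1 (a c : M) (e : (1 * a)%g = c) (e' : a = c) (x : A a) :
  tr e (push 1%g x) = tr e' x.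
Proof. by case: c / e' e => e; rewrite -[RHS]push1; exact: tr_irr. Qed.

Lemma cx_act_inj E (m : M) (n : fiber (@cx_proj M A E) m) (x y : A m) :
  cx_act x n = cx_act y n -> x = y.
Proof.
move=> e; have [z [_ z_uniq]] := cx_act_unique n (cx_act x n).
by rewrite -(z_uniq x erefl) -(z_uniq y e).
Qed.

Lemma cx_act_trans E (m : M) (n n' : fiber (@cx_proj M A E) m) :
  exists x : A m, n' = cx_act x n.
Proof. by have [x [e _]] := cx_act_unique n n'; exists x. Qed.

(** Elements of fibres over equal but not convertible points of [M], such as
    [(ab)c] and [a(bc)], can only be compared in [E]; this lemma and the next
    carry the action and its freeness across such an equality. *)
Lemma cx_act_tr E (m m' : M) (e : m = m') (x : A m)
    (n : fiber (@cx_proj M A E) m) (n' : fiber (@cx_proj M A E) m') :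
  val n = val n' -> val (cx_act x n) = val (cx_act (tr e x) n').
Proof.
by case: m' / e n' => n' enn'; rewrite (val_inj enn') tr_id.
Qed.

Lemma cx_act_val_inj E (m m' : M) (e : m = m') (x : A m) (x' : A m')
    (n : fiber (@cx_proj M A E) m) (n' : fiber (@cx_proj M A E) m') :
  val n = val n' -> val (cx_act x n) = val (cx_act x' n') -> tr e x = x'.
Proof.
move=> enn'; rewrite (cx_act_tr e x enn') => exx'.
exact/(@cx_act_inj E _ n')/val_inj.
Qed.

(** Writing [n = x . 1], idempotence says [x + x = x]. *)
Lemma idempotent_over_1 E (n : E) :
  cx_proj n = 1%g -> (n * n)%g = n -> n = 1%g.
Proof.
move=> /eqP pn nn; pose n1 : fiber (@cx_proj M A E) 1%g := exist _ n pn.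
have p1 : cx_proj (1%g : E) == 1%g by rewrite (fst (cx_proj_morph E)).
pose u : fiber (@cx_proj M A E) 1%g := exist _ 1%g p1.
have [x ex] := cx_act_trans u n1.
have e : (1 * 1 = 1 :> M)%g by exact: mul1g.
have push1E (y : A 1%g) : tr e (push 1%g y) = y.
  exact: (tr_push1 e erefl).
have := congr1 val (cx_act_mul x u x u); rewrite -ex /= nn -[n]/(val n1) ex.
rewrite (@cx_act_tr E _ _ e _ _ u) /= ?mul1g // trD tr_tr.
rewrite (tr_irr _ e) !push1E => /val_inj/cx_act_inj/eqP.
rewrite -subr_eq0 opprD addNKr oppr_eq0 => /eqP x0.
by have := congr1 val ex; rewrite x0 cx_act0.
Qed.

(** The unit is preserved for free: its image is an idempotent over [1]. *)
Lemma multiplicative_over_morphism E E' (h : E -> E') :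
  (forall n, cx_proj (h n) = cx_proj n) ->
  {morph h : n n' / (n * n')%g} -> monoid.monoid_morphism h.
Proof.
move=> hp hM; split=> //; apply: idempotent_over_1.
  by rewrite hp (fst (cx_proj_morph E)).
by rewrite -hM mul1g.
Qed.

(** Equivariance with the target written as any [n'] equal to [h n] in the
    monoid, whatever the proof that it lies over [m]. *)
Lemma ch_actE E E' (h : coext_hom E E') (m : M) (x : A m)
    (n : fiber (@cx_proj M A E) m) (n' : fiber (@cx_proj M A E') m) :
  val n' = h (val n) -> h (val (cx_act x n)) = val (cx_act x n').
Proof.
move=> e; have <- : fiber_map (ch_proj h) n = n' by exact: val_inj.
exact: (congr1 val (ch_act h x n)).
Qed.

(** On each fibre, an equivariant map between torsors under the same group. *)
Lemma coext_hom_bij E E' (h : coext_hom E E') : bijective h.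
Proof.
have inj : injective h.
  move=> n1 n2 e.
  have e2 : cx_proj n2 == cx_proj n1 by rewrite -!(ch_proj h) e.
  pose u := exist _ n1 (eqxx _) : fiber (@cx_proj M A E) (cx_proj n1).
  pose v := exist _ n2 e2 : fiber (@cx_proj M A E) (cx_proj n1).
  have [x ex] := cx_act_trans u v.
  have e1 : fiber_map (ch_proj h) u = fiber_map (ch_proj h) v by exact: val_inj.
  have : cx_act x (fiber_map (ch_proj h) u) =
      cx_act 0 (fiber_map (ch_proj h) u).
    by rewrite -ch_act -ex cx_act0 e1.
  by move=> /cx_act_inj x0; have := congr1 val ex; rewrite x0 cx_act0.
have surj n' : exists n, h n = n'.
  have [n pn] := cx_proj_surj E (cx_proj n').
  pose u := exist _ n (introT eqP pn) : fiber (@cx_proj M A E) (cx_proj n').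
  pose v := exist _ n' (eqxx _) : fiber (@cx_proj M A E') (cx_proj n').
  have [x ex] := cx_act_trans (fiber_map (ch_proj h) u) v.
  exists (val (cx_act x u)).
  by rewrite (ch_actE (n' := fiber_map (ch_proj h) u) x erefl) -ex.
have [k kK] := choice surj.
by exists k => // n; apply: inj; rewrite kK.
Qed.

Lemma Coext_groupoid : is_groupoid (Coext A).
Proof.
move=> E E' h; have [k hK kK] := coext_hom_bij h.
have kp n' : cx_proj (k n') = cx_proj n' by rewrite -(ch_proj h) kK.
have kM : monoid.monoid_morphism k.
  apply: multiplicative_over_morphism => // n1 n2; apply: (can_inj hK).
  by rewrite (snd (ch_morph h)) !kK.
have kact (m : M) (x : A m) (n : fiber (@cx_proj M A E') m) :
    fiber_map kp (cx_act x n) = cx_act x (fiber_map kp n).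
  apply/val_inj/(can_inj hK); rewrite /= kK.
  by apply/esym/ch_actE; rewrite /= kK.
exists (CoextHom kM kact : @Hom (Coext A) E' E).
by split; apply: coext_hom_eq => n /=; rewrite (hK, kK).
Qed.

End CoextensionTheory.

(** * The coextension of a cocycle *)

Section TwistedProduct.
Variables (M : comMonoidType) (A : system M).

Local Notation coc f := (C1_val (ker_val f)).

(** The vanishing of [d1 f] with its negative terms moved to the right, which is
    the form in which it expresses associativity of the twisted product. *)
Lemma cocycle_eq (f : ker (@d1 M A)) (a b c : M) :
  tr (mulgA a b c) (push a (coc f b c)) + tr (mulgA a b c) (coc f a (b * c)%g) =
  tr (mulgC c (a * b)%g) (push c (coc f a b)) + coc f (a * b)%g c.
Proof.
case: f => f /= /eqP/(congr1 (fun h : C2 A => val h a b c)) /= e.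
apply: subr0_eq; rewrite -[RHS]e opprD !addrA [LHS](ACl (1*4*2*3)).
by [].
Qed.

(** At [(1, 1, c)] two terms of the cocycle identity cancel; this is what makes
    [(1, - f 1 1)] a unit for the twisted product. *)
Lemma cocycle1 (f : ker (@d1 M A)) (c : M) :
  coc f 1%g c = tr (mulgC c 1%g) (push c (tr (mul1g 1%g) (coc f 1%g 1%g))).
Proof.
pose e := mulgA 1%g 1%g c.
have e1 : (1 * c = c)%g := mul1g c.
have e1' : (1 * c = 1 * 1 * c)%g by rewrite !mul1g.
have E1 : tr e (push 1%g (coc f 1%g c)) = tr e1' (coc f 1%g c).
  exact: tr_push1.
have E2 : tr e (coc f 1%g (1 * c)%g) = tr e1' (coc f 1%g c).
  rewrite -(tr_dep (k := fun x => (1 * x)%g) (fun x => coc f 1%g x) e1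
              (congr1 (monoid.mul 1%g) e1)).
  by rewrite tr_tr; exact: tr_irr.
have E3 : tr e1' (coc f 1%g c) = coc f (1 * 1)%g c.
  exact: (tr_dep (k := fun x => (x * c)%g) (fun x => coc f x c)
           (esym (mul1g 1%g))).
(* The terms [f 1 (1c)] and [f (11) c] agree and cancel. *)
have := cocycle_eq f 1%g 1%g c.
rewrite -/e E1 E2 -E3 => /addIr/(congr1 (tr (esym e1'))).
rewrite !tr_tr tr_id => ->.
by rewrite push_tr tr_tr; exact: tr_irr.
Qed.

(** The carrier does not depend on [f]; the argument is there so that each
    cocycle gets its own monoid structure. *)
Definition twisted (f : ker (@d1 M A)) : Type := {m : M & A m}.

Section TwistedMonoid.
Variable f : ker (@d1 M A).

Definition pt (m : M) (x : A m) : twisted f := existT (fun m => A m) m x.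

(** Equality in the total space may be checked after transport. *)
Lemma pt_tr (a b : M) (e : a = b) (x : A a) (y : A b) :
  tr e x = y -> pt x = pt y.
Proof. by move=> <- {y}; case: b / e. Qed.

HB.instance Definition _ := Choice.on (twisted f).

Definition twisted_mul (u v : twisted f) : twisted f :=
  let: existT a x := u in let: existT b y := v in
  pt (tr (mulgC b a) (push b x) + push a y + coc f a b).

Definition twisted_one : twisted f := pt (- tr (mul1g 1%g) (coc f 1%g 1%g)).

Lemma twisted_mulC : commutative twisted_mul.
Proof.
case=> [a x] [b y]; apply: (pt_tr (e := mulgC a b)).
rewrite !trD tr_tr tr_id (C1_sym (ker_val f)).
by rewrite [X in X + _]addrC.
Qed.

Lemma twisted_mulA : associative twisted_mul.
Proof.
case=> [a x] [b y] [c z]; apply: (pt_tr (e := mulgA a b c)).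
rewrite !(trD, raddfD) /= !(push_tr, push_push, tr_tr) tr_id.
rewrite (push_l x (mulgC c b) _
  (etrans (mulgC (b * c)%g a) (mulgA a b c))).
rewrite (push_l y (mulgC a c) _
  (etrans (esym (mulgA c a b)) (mulgC c (a * b)%g))).
rewrite !addrA -[LHS]addrA cocycle_eq !addrA.
by congr (_ + _); rewrite addrAC.
Qed.

Lemma twisted_mul1l : left_id twisted_one twisted_mul.
Proof.
case=> [c z]; apply: (pt_tr (e := mul1g c)).
rewrite (cocycle1 f c) !raddfN /= addrAC addNr add0r.
exact: push1.
Qed.

Lemma twisted_mul1r : right_id twisted_one twisted_mul.
Proof. by move=> u; rewrite twisted_mulC twisted_mul1l. Qed.

HB.instance Definition _ := monoid.isMonoid.Build (twisted f)
  twisted_mulA twisted_mul1l twisted_mul1r.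
HB.instance Definition _ := Magma_isCommutative.Build (twisted f) twisted_mulC.

Definition twisted_proj (u : twisted f) : M := tag u.

Lemma twisted_proj_morph : monoid.monoid_morphism twisted_proj.
Proof. by split=> // [[a x] [b y]]. Qed.

Lemma twisted_proj_surj (m : M) : exists u, twisted_proj u = m.
Proof. by exists (pt (0 : A m)). Qed.

(** [in_fib] and [coord] identify the fibre over [m] with the group [A m]; the
    action is translation in this coordinate. *)
Definition in_fib (m : M) (x : A m) : fiber twisted_proj m :=
  exist _ (pt x) (eqxx m).

Definition coord (m : M) (n : fiber twisted_proj m) : A m :=
  tr (eqP (valP n)) (tagged (val n)).

Lemma coordK (m : M) : cancel (@coord m) (@in_fib m).
Proof.
case=> [[a x] /= e]; apply: val_inj; rewrite /coord /=.
exact: esym (pt_tr erefl).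
Qed.

Lemma in_fibK (m : M) : cancel (@in_fib m) (@coord m).
Proof. by move=> x; exact: tr_id. Qed.

Definition twisted_act (m : M) (x : A m) (n : fiber twisted_proj m) :
  fiber twisted_proj m := in_fib (x + coord n).

Lemma twisted_act0 (m : M) (n : fiber twisted_proj m) : twisted_act 0 n = n.
Proof. by rewrite /twisted_act add0r coordK. Qed.

Lemma twisted_actD (m : M) (x y : A m) (n : fiber twisted_proj m) :
  twisted_act (x + y) n = twisted_act x (twisted_act y n).
Proof. by rewrite /twisted_act in_fibK addrA. Qed.

Lemma twisted_act_unique (m : M) (n n' : fiber twisted_proj m) :
  exists! x : A m, n' = twisted_act x n.
Proof.
exists (coord n' - coord n); split=> [|x ->].
  by rewrite /twisted_act subrK coordK.
by rewrite in_fibK addrK.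
Qed.

Lemma twisted_act_mul (m m' : M) (x : A m) (n : fiber twisted_proj m)
    (y : A m') (n' : fiber twisted_proj m') :
  fiber_mul twisted_proj_morph (twisted_act x n) (twisted_act y n') =
  twisted_act (tr (mulgC m' m) (push m' x) + push m y)
      (fiber_mul twisted_proj_morph n n').
Proof.
rewrite -(coordK n) -(coordK n'); set u := coord n; set v := coord n'.
have -> : fiber_mul twisted_proj_morph (in_fib u) (in_fib v) =
    in_fib (tr (mulgC m' m) (push m' u) + push m v + coc f m m').
  exact: val_inj.
apply: val_inj; rewrite /twisted_act !in_fibK /=; congr pt.
by rewrite !(raddfD, trD) /= !addrA [LHS](ACl (1*3*2*4*5)).
Qed.

Definition twisted_coext : coextension A :=
  Coextension twisted_proj_surj twisted_act0 twisted_actD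
    twisted_act_unique twisted_act_mul.

End TwistedMonoid.

(** * Functoriality *)

Section Shift.
Variables (f f' : ker (@d1 M A)).

Lemma coboundary_eqP (g : C0 A) :
  d0_ker g + f' = f <->
  forall a b, coc f a b =
    push a (g b) - g (a * b)%g + tr (mulgC b a) (push b (g a)) + coc f' a b.
Proof.
split=> [<- //|e]; apply/val_inj/val_inj.
apply: functional_extensionality_dep => a.
apply: functional_extensionality_dep => b.
exact/esym/e.
Qed.

Definition shift (g : C0 A) (u : twisted f) : twisted f' :=
  let: existT a x := u in pt f' (x + g a).

Variable k : action_hom (@d0_ker M A : {additive C0 A -> ker (@d1 M A)}) f f'.

Definition shift_hom_fun : twisted_coext f -> twisted_coext f' := shift (val k).

Lemma shift_proj (u : twisted_coext f) :
  cx_proj (shift_hom_fun u) = cx_proj u.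
Proof. by case: u. Qed.

(** Writing [f] as [f'] plus the coboundary of [g], the term [- g (ab)] of the
    coboundary cancels the shift of the product, and its other two terms
    [b_* (g a)] and [a_* (g b)] are the shifts of the factors. *)
Lemma shiftM : {morph shift_hom_fun : u v / (u * v)%g}.
Proof.
case=> [a x] [b y]; congr pt.
have /coboundary_eqP -> := eqP (valP k).
rewrite !raddfD /= !addrA.
set g := val k.
by rewrite [LHS](ACl (1*5*2*3*6*(4*7))) /= addNr addr0.
Qed.

Lemma shift_act (m : M) (x : A m)
  (n : fiber (@cx_proj M A (twisted_coext f)) m) :
  fiber_map shift_proj (cx_act x n) = cx_act x (fiber_map shift_proj n).
Proof.
rewrite -(coordK n); set u := coord n; apply: val_inj.
have -> : fiber_map shift_proj (in_fib f u) = in_fib f' (u + val k m).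
  exact: val_inj.
rewrite /= /twisted_act !in_fibK /=; congr pt.
by rewrite addrA.
Qed.

Definition shift_hom : coext_hom (twisted_coext f) (twisted_coext f') :=
  CoextHom (multiplicative_over_morphism shift_proj shiftM) shift_act.

End Shift.

Lemma pt_inj (f : ker (@d1 M A)) (m : M) : injective (@pt f m).
Proof. by move=> x y /eqP; rewrite eq_Tagged => /eqP. Qed.

Definition cocycle_groupoid : category :=
  action_groupoid (@d0_ker M A : {additive C0 A -> ker (@d1 M A)}).

Lemma shift_id (f : cocycle_groupoid) :
  shift_hom (idm f) = idm (twisted_coext f : Coext A).
Proof. by apply: coext_hom_eq => -[a x]; congr pt; exact: addr0. Qed.

Lemma shift_comp (f f' f'' : cocycle_groupoid)
  (k' : Hom f' f'') (k : Hom f f') :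
  shift_hom (comp k' k) =
  comp (shift_hom k' : @Hom (Coext A) _ _) (shift_hom k).
Proof.
apply: coext_hom_eq => -[a x]; congr pt.
rewrite /= -addrA; congr (_ + _); exact: addrC.
Qed.

Definition twisted_functor : functor cocycle_groupoid (Coext A) :=
  @Functor cocycle_groupoid (Coext A) twisted_coext shift_hom
    shift_id shift_comp.

(** Equivariance forces [h (a, x) = (a, x + g a)], where [h (a, 0) = (a, g a)]. *)
Lemma twisted_functor_fully_faithful : fully_faithful twisted_functor.
Proof.
move=> f f' h.
pose g : C0 A := fun a => coord (fiber_map (ch_proj h) (in_fib f (0 : A a))).
have hE a (x : A a) : h (pt f x) = pt f' (x + g a).
  have -> : pt f x = val (@cx_act M A (twisted_coext f) a x (in_fib f 0)).
    by rewrite /= in_fibK addr0.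
  by rewrite (ch_actE (n' := fiber_map (ch_proj h) (in_fib f 0)) x erefl).
have gP : d0_ker g + f' == f.
  apply/eqP/coboundary_eqP => a b.
  (* Compare the images of both sides of [(a, 0) (b, 0) = (ab, f a b)]. *)
  have := snd (ch_morph h) (pt f (0 : A a)) (pt f (0 : A b)).
  rewrite [X in h X](_ : _ = pt f (coc f a b)); last first.
    by congr pt; rewrite !raddf0 !add0r.
  rewrite !hE !add0r => /pt_inj e.
  apply: (addIr (g (a * b)%g)); rewrite e.
  by rewrite [RHS](ACl (3*1*4*(2*5))) /= addNr addr0.
exists (exist _ g gP); split=> [|[g' g'P] e].
  by apply: coext_hom_eq => -[a x]; rewrite /= hE.
apply: val_inj; apply: functional_extensionality_dep => a /=.
by have := hE a 0; rewrite -{1}e => /pt_inj; rewrite !add0r.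
Qed.

(** * The cocycle of a transversal *)

Section Transversal.
Variables (E : coextension A) (s : forall m, fiber (@cx_proj M A E) m).
Variable c : forall a b, A (a * b)%g.
Hypothesis sM : forall a b,
  fiber_mul (cx_proj_morph E) (s a) (s b) = cx_act (c a b) (s (a * b)%g).

Lemma transversal_cocycle_sym : (c : fun2 A) \in @C1_pred M A.
Proof.
apply/asboolP => a b; apply/esym/(@cx_act_val_inj M A E _ _ _ _ _
  (s (b * a)%g) (s (a * b)%g)).
  by rewrite (mulgC b a).
by rewrite -!sM /= mulgC.
Qed.

(** With [s] as base points, [E] multiplies by the formula of the twisted
    product. *)
Lemma transversal_mul a b (x : A a) (y : A b) :
  (val (cx_act x (s a)) * val (cx_act y (s b)))%g =
  val (cx_act (tr (mulgC b a) (push b x) + push a y + c a b) (s (a * b)%g)).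
Proof.
by rewrite cx_actD -sM -cx_act_mul.
Qed.

Definition transversal_cochain : C1 A := MkC1 transversal_cocycle_sym.

(** Associativity of [E] on [s a], [s b], [s d], read in the coordinates of the
    fibre over [abd]. *)
Lemma transversal_cocycle : transversal_cochain \in ker_pred (@d1 M A).
Proof.
apply/eqP/val_inj; apply: functional_extensionality_dep => a.
apply: functional_extensionality_dep => b.
apply: functional_extensionality_dep => d.
have e : tr (mulgA a b d) (push a (c b d) + c a (b * d)%g) =
    tr (mulgC d (a * b)%g) (push d (c a b)) + c (a * b)%g d.
  apply: (@cx_act_val_inj M A E _ _ _ _ _
    (s (a * (b * d))%g) (s (a * b * d)%g)).
    by rewrite mulgA.
  have sM0 a' b' : (val (s a') * val (s b'))%g =
      val (cx_act (c a' b') (s (a' * b')%g)).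
    by rewrite -sM.
  have := mulgA (val (s a)) (val (s b)) (val (s d)).
  rewrite !sM0 -{1}[s a]cx_act0 -{1}[s d]cx_act0 !transversal_mul.
  by rewrite !raddf0 add0r addr0.
rewrite /= /d1_fun /= [LHS](ACl ((1*3)*4*2)) /= -trD e.
by rewrite addrAC addrK subrr.
Qed.

Definition transversal_ker : ker (@d1 M A) := Ker transversal_cocycle.

Definition transversal_fun (u : twisted_coext transversal_ker) : E :=
  let: existT a x := u in val (cx_act x (s a)).

Lemma transversal_proj u : cx_proj (transversal_fun u) = cx_proj u.
Proof. by case: u => a x; exact/eqP/(valP (cx_act x (s a))). Qed.

Lemma transversal_morph : {morph transversal_fun : u v / (u * v)%g}.
Proof. by case=> [a x] [b y]; rewrite /= transversal_mul. Qed.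

Lemma transversal_act (m : M) (x : A m)
    (n : fiber (@cx_proj M A (twisted_coext transversal_ker)) m) :
  fiber_map transversal_proj (cx_act x n) =
  cx_act x (fiber_map transversal_proj n).
Proof.
rewrite -(coordK n); set u := coord n; apply: val_inj.
have -> : fiber_map transversal_proj (in_fib transversal_ker u) = cx_act u (s m).
  exact: val_inj.
by rewrite -cx_actD /= /twisted_act in_fibK.
Qed.

Definition transversal_hom : coext_hom (twisted_coext transversal_ker) E :=
  CoextHom (multiplicative_over_morphism transversal_proj transversal_morph)
    transversal_act.

End Transversal.

Lemma twisted_functor_essentially_surjective :
  essentially_surjective twisted_functor.
Proof.
move=> E.
have fib m : exists n : fiber (@cx_proj M A E) m, True.
  by have [n /eqP pn] := cx_proj_surj E m; exists (exist _ n pn).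
pose s m := projT1 (cid (fib m)).
have fac a b := cx_act_trans (s (a * b)%g)
  (fiber_mul (cx_proj_morph E) (s a) (s b)).
pose c a b := projT1 (cid (fac a b)).
have sM a b : fiber_mul (cx_proj_morph E) (s a) (s b) =
    cx_act (c a b) (s (a * b)%g).
  exact: projT2 (cid (fac a b)).
exists (transversal_ker sM), (transversal_hom sM).
exact: Coext_groupoid.
Qed.

End TwistedProduct.

Theorem theorem4p4 (M : comMonoidType) (A : system M) :
  let D : category :=
    action_groupoid (@d0_ker M A : {additive C0 A -> ker (@d1 M A)}) in
  is_groupoid (Coext A) /\ is_groupoid D /\ equivalent (Coext A) D.
Proof.
move=> D; split; first exact: Coext_groupoid.
split; first exact: action_groupoid_is_groupoid.
exact: equivalent_of_functor (@twisted_functor_fully_faithful M A)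
  (@twisted_functor_essentially_surjective M A).
Qed.
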